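(* Let $M$ be an orientable surface in $E^3$, let $\alpha:[0,l]\times[0,w)\to M\subset E^3$, $(u,t)\mapsto\alpha(u,t)$, be a one-parameter family of differentiable curves on $M$ with speed $v=\left\|\frac{\partial\alpha}{\partial u}\right\|>0$, let $\{T,g,n\}$ be the Darboux frame of $\alpha$ on $M$, and let $\frac{\partial\alpha}{\partial t}=f_1T+f_2g+f_3n$ be a differentiable flow of $\alpha$, with scalar functions $f_1,f_2,f_3$ of $(u,t)$. Then the flow is inextensible if and only if $$\frac{\partial f_1}{\partial s}=f_2k_g+f_3k_n.$$
   Context: $M$ is oriented by a unit normal field. For each fixed $t$, the curve $u\mapsto\alpha(u,t)$ lies on $M$; ''differentiable'' means differentiable enough that all derivatives involved exist and mixed partial derivatives commute. $\frac{\partial}{\partial s}=\frac1v\frac{\partial}{\partial u}$ denotes the derivative with respect to arclength along the curve at fixed $t$. The Darboux frame $\{T,g,n\}$ along the curve: $T=\frac{\partial\alpha}{\partial s}$ is the unit tangent, $n$ is the unit normal of $M$ along the curve, $g=n\times T$. The geodesic curvature $k_g$, normal curvature $k_n$ and geodesic torsion $\tau_g$ are defined by $$\frac{\partial T}{\partial s}=k_gg+k_nn,\quad \frac{\partial g}{\partial s}=-k_gT+\tau_gn,\quad \frac{\partial n}{\partial s}=-k_nT-\tau_gg.$$ The curve evolution $\alpha$ and its flow $\frac{\partial\alpha}{\partial t}$ are called inextensible if $\frac{\partial}{\partial t}\left\|\frac{\partial\alpha}{\partial u}\right\|=0$ for all $(u,t)$. *)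

(* Defs.v *)
From Stdlib Require Import Reals ClassicalEpsilon Lra.
From Coquelicot Require Import Coquelicot.

Local Open Scope R_scope.

(* Coquelicot's product norm is [sqrt (norm x ^ 2 + norm y ^ 2)], so [norm] on
   these types is the Euclidean norm (see [norm_E3]). *)
Definition E2 : NormedModule R_AbsRing :=
  prod_NormedModule R_AbsRing R_NormedModule R_NormedModule.
Definition E3 : NormedModule R_AbsRing :=
  prod_NormedModule R_AbsRing
    (prod_NormedModule R_AbsRing R_NormedModule R_NormedModule) R_NormedModule.

Definition vec (x y z : R) : E3 := ((x, y), z).
Definition cx (a : E3) : R := fst (fst a).
Definition cy (a : E3) : R := snd (fst a).
Definition cz (a : E3) : R := snd a.

Definition dot (a b : E3) : R := cx a * cx b + cy a * cy b + cz a * cz b.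

Definition cross (a b : E3) : E3 :=
  vec (cy a * cz b - cz a * cy b)
      (cz a * cx b - cx a * cz b)
      (cx a * cy b - cy a * cx b).

Lemma norm_E3 (a : E3) : norm a = sqrt (dot a a).
Proof.
destruct a as [[x y] z].
assert (Hn : forall r : R, (norm r) ^ 2 = r * r).
{ intros r. change (norm r) with (Rabs r). rewrite pow2_abs. ring. }
change (sqrt ((sqrt ((norm x) ^ 2 + (norm y) ^ 2)) ^ 2 + (norm z) ^ 2)
        = sqrt (x * x + y * y + z * z)).
rewrite pow2_sqrt, !Hn; [reflexivity | rewrite !Hn; nra].
Qed.

(* Derivative of [f] at [x] where only increments staying in [D] are used; at an
   endpoint of an interval [D] this is the one-sided derivative. *)
Definition is_deriv_on {V : NormedModule R_AbsRing}
    (D : R -> Prop) (f : R -> V) (x : R) (a : V) : Prop :=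
  filterdiff f (within D (locally x)) (fun h : R => scal h a).

Definition ex_deriv_on {V : NormedModule R_AbsRing}
    (D : R -> Prop) (f : R -> V) (x : R) : Prop :=
  exists a : V, is_deriv_on D f x a.

(* Arbitrary when the derivative does not exist. *)
Definition deriv_on {V : NormedModule R_AbsRing}
    (D : R -> Prop) (f : R -> V) (x : R) : V :=
  epsilon (inhabits zero) (is_deriv_on D f x).

(* [x : U -> V /\ M] is a local parametrization: a homeomorphism with inverse
   [y], continuously differentiable, with injective differential [dx q] at every
   point [q] of the open set [U].  Pointwise continuity of [dx] is continuity for
   the operator norm, as the domain is finite dimensional. *)
Record is_chart (M : E3 -> Prop) (U : E2 -> Prop) (V : E3 -> Prop)
    (x : E2 -> E3) (dx : E2 -> E2 -> E3) (y : E3 -> E2) : Prop := {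
  chart_open_dom : open U;
  chart_open_cod : open V;
  chart_image : forall q, U q -> V (x q) /\ M (x q);
  chart_inv_image : forall p, V p -> M p -> U (y p) /\ x (y p) = p;
  chart_inv : forall q, U q -> y (x q) = q;
  chart_inv_cont : continuous_on (fun p => V p /\ M p) y;
  chart_diff : forall q, U q -> filterdiff x (locally q) (dx q);
  chart_diff_cont : forall h, continuous_on U (fun q => dx q h);
  chart_regular : forall q h, U q -> dx q h = zero -> h = zero
}.

Definition regular_surface (M : E3 -> Prop) : Prop :=
  forall p, M p -> exists U V x dx y, is_chart M U V x dx y /\ V p.

Definition tangent_vector (M : E3 -> Prop) (p a : E3) : Prop :=
  exists U V x dx y q h,
    is_chart M U V x dx y /\ U q /\ x q = p /\ dx q h = a.

Definition unit_normal_field (M : E3 -> Prop) (N : E3 -> E3) : Prop :=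
  continuous_on M N /\
  forall p, M p ->
    norm (N p) = 1 /\ forall a, tangent_vector M p a -> dot (N p) a = 0.

Definition u_dom (l u : R) : Prop := 0 <= u <= l.
Definition t_dom (w t : R) : Prop := 0 <= t < w.

Definition ex_du {V : NormedModule R_AbsRing} (l : R) (f : R -> R -> V) (u t : R) :=
  ex_deriv_on (u_dom l) (fun u' => f u' t) u.
Definition ex_dt {V : NormedModule R_AbsRing} (w : R) (f : R -> R -> V) (u t : R) :=
  ex_deriv_on (t_dom w) (fun t' => f u t') t.

Definition du {V : NormedModule R_AbsRing} (l : R) (f : R -> R -> V) (u t : R) : V :=
  deriv_on (u_dom l) (fun u' => f u' t) u.
Definition dt {V : NormedModule R_AbsRing} (w : R) (f : R -> R -> V) (u t : R) : V :=
  deriv_on (t_dom w) (fun t' => f u t') t.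

Definition speed (l : R) (alpha : R -> R -> E3) (u t : R) : R :=
  norm (du l alpha u t).

Definition ds {V : NormedModule R_AbsRing} (l : R) (alpha : R -> R -> E3)
    (f : R -> R -> V) (u t : R) : V :=
  scal (/ speed l alpha u t) (du l f u t).

Definition frame_T (l : R) (alpha : R -> R -> E3) (u t : R) : E3 :=
  ds l alpha alpha u t.
Definition frame_n (N : E3 -> E3) (alpha : R -> R -> E3) (u t : R) : E3 :=
  N (alpha u t).
Definition frame_g (l : R) (N : E3 -> E3) (alpha : R -> R -> E3) (u t : R) : E3 :=
  cross (frame_n N alpha u t) (frame_T l alpha u t).

Definition darboux_equations (l w : R) (N : E3 -> E3) (alpha : R -> R -> E3)
    (kg kn taug : R -> R -> R) : Prop :=
  let T := frame_T l alpha in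
  let g := frame_g l N alpha in
  let n := frame_n N alpha in
  forall u t, u_dom l u -> t_dom w t ->
    ds l alpha T u t = plus (scal (kg u t) (g u t)) (scal (kn u t) (n u t)) /\
    ds l alpha g u t = plus (scal (- kg u t) (T u t)) (scal (taug u t) (n u t)) /\
    ds l alpha n u t = plus (scal (- kn u t) (T u t)) (scal (- taug u t) (g u t)).

Definition is_flow (l w : R) (N : E3 -> E3) (alpha : R -> R -> E3)
    (f1 f2 f3 : R -> R -> R) : Prop :=
  forall u t, u_dom l u -> t_dom w t ->
    dt w alpha u t =
      plus (plus (scal (f1 u t) (frame_T l alpha u t))
                 (scal (f2 u t) (frame_g l N alpha u t)))
           (scal (f3 u t) (frame_n N alpha u t)).

(* The standing assumption "differentiable enough": the derivatives that occur exist, and the mixed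
   second partial derivatives of [alpha] commute. *)
Record differentiable_enough (l w : R) (N : E3 -> E3) (alpha : R -> R -> E3)
    (f1 f2 f3 : R -> R -> R) (u t : R) : Prop := {
  alpha_du : ex_du l alpha u t;
  alpha_dt : ex_dt w alpha u t;
  alpha_dudu : ex_du l (du l alpha) u t;
  alpha_dtdu : ex_dt w (du l alpha) u t;
  alpha_dudt : ex_du l (dt w alpha) u t;
  alpha_mixed : dt w (du l alpha) u t = du l (dt w alpha) u t;
  normal_du : ex_du l (frame_n N alpha) u t;
  f1_du : ex_du (V := R_NormedModule) l f1 u t;
  f2_du : ex_du (V := R_NormedModule) l f2 u t;
  f3_du : ex_du (V := R_NormedModule) l f3 u t
}.

Definition inextensible (l w : R) (alpha : R -> R -> E3) : Prop :=
  forall u t, u_dom l u -> t_dom w t ->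
    is_deriv_on (V := R_NormedModule) (t_dom w) (fun t' => speed l alpha u t') t 0.

(* Main.v *)
Require Import Defs.
From Stdlib Require Import Reals ClassicalEpsilon Lra Psatz.
From Coquelicot Require Import Coquelicot.

Local Open Scope R_scope.

(* As [v^2 = alpha_u . alpha_u], the mixed partials commuting gives
   [v_t = T . (alpha_t)_u].  Differentiating [T . alpha_t = f1] in [u] and using
   [T_u = v (kg g + kn n)] turns this into [v_t = v (ds f1 - f2 kg - f3 kn)],
   which vanishes exactly when the stated equation holds.  The Darboux equations do
   not force [T . n = 0]: this comes from the curve lying on [M]. *)

(** * Derivatives relative to a subset of the line *)

Lemma minus_minus_cancel {G : AbelianGroup} (a b c : G) :
  minus (minus a b) (minus a c) = minus c b.
Proof.
rewrite (minus_trans a c b), plus_comm, <- (opp_minus a c). reflexivity.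
Qed.

Lemma minus_zero_eq {G : AbelianGroup} (a b : G) : minus a b = zero -> a = b.
Proof.
intros E. apply (plus_reg_r (opp b)). rewrite plus_opp_r. exact E.
Qed.

Section DerivOn.

Context {V : NormedModule R_AbsRing} (D : R -> Prop) (x : R).

Lemma within_proper : D x -> ProperFilter (within D (locally x)).
Proof.
intros Dx; constructor.
- intros P HP. exists x. exact (locally_singleton _ _ HP Dx).
- apply within_filter, locally_filter.
Qed.

Lemma within_lim : is_filter_lim (within D (locally x)) x.
Proof. intros P HP. now apply filter_le_within. Qed.

(** [x] lies in every set of the filter, hence in every ball around [z]. Since [filterdiff]
    quantifies over all limits of its filter, this reduces it to a single estimate at [x]. *)
Lemma within_lim_unique (z : R) :
  D x -> is_filter_lim (within D (locally x)) z -> z = x.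
Proof.
intros Dx Hz. apply eq_close. intros eps.
exact (locally_singleton _ _ (Hz _ (locally_ball z eps)) Dx).
Qed.

Lemma is_deriv_on_iff (f : R -> V) (a : V) : D x ->
  is_deriv_on D f x a <->
  forall eps : posreal, within D (locally x) (fun z =>
    norm (minus (minus (f z) (f x)) (scal (z - x) a)) <= eps * Rabs (z - x)).
Proof.
intros Dx; split.
- intros [_ H]. exact (H x within_lim).
- intros H; split; [exact (is_linear_scal_l a)|].
  intros z Hz. rewrite (within_lim_unique z Dx Hz). exact H.
Qed.

Lemma is_deriv_on_continuous (f : R -> V) (a : V) :
  is_deriv_on D f x a -> filterlim f (within D (locally x)) (locally (f x)).
Proof.
intros H. apply filterdiff_continuous_aux.
- eexists; exact H.
- apply within_lim.
Qed.

Lemma is_deriv_on_ext (f g : R -> V) (a : V) : D x ->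
  (forall z, D z -> f z = g z) -> is_deriv_on D f x a -> is_deriv_on D g x a.
Proof.
intros Dx E. apply filterdiff_ext_loc.
- exact (filter_forall (F := locally x) _ E).
- intros z Hz. rewrite (within_lim_unique z Dx Hz). now apply E.
Qed.

Lemma is_deriv_on_const (v : V) : is_deriv_on D (fun _ => v) x zero.
Proof.
apply filterdiff_ext_lin with (fun _ : R => zero).
- apply (filterdiff_const (U := R_NormedModule)).
- intros y. symmetry. apply (scal_zero_r (V := V) (y : R_AbsRing)).
Qed.

Lemma is_deriv_on_comp {W : NormedModule R_AbsRing} (f : R -> V) (a : V)
    (h lh : V -> W) : D x ->
  is_deriv_on D f x a -> filterdiff h (locally (f x)) lh ->
  is_deriv_on D (fun z => h (f z)) x (lh a).
Proof.
intros Dx Hf Hh.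
pose proof (within_proper Dx) as PF.
unfold is_deriv_on.
apply filterdiff_ext_lin with (fun y => lh (scal y a)).
- apply (filterdiff_comp f h (fun y => scal y a) lh Hf).
  (* By continuity of [f], the image filter converges to [f x], so the differential of [h] at [f x]
     also serves along it. *)
  apply filterdiff_locally with (f x); [|exact Hh].
  intros P HP. exact (is_deriv_on_continuous f a Hf P HP).
- intros y. destruct Hh as [L _]. apply (linear_scal _ L).
Qed.

Lemma is_deriv_on_scal (k : R -> R) (f : R -> V) (dk : R) (a : V) : D x ->
  is_deriv_on (V := R_NormedModule) D k x dk -> is_deriv_on D f x a ->
  is_deriv_on D (fun z => scal (k z) (f z)) x
    (plus (scal dk (f x)) (scal (k x) a)).
Proof.
intros Dx Hk Hf.
pose proof (within_proper Dx) as PF.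
unfold is_deriv_on.
eapply filterdiff_ext_lin.
- refine (filterdiff_comp_2 (U := R_NormedModule) k f (fun c v => scal c v)
    _ _ (fun c v => plus (scal c (f x)) (scal (k x) v)) Hk Hf _).
  (* Scalar multiplication is differentiable along every filter converging to [(k x, f x)]; this
     convergence is checked on balls, one factor at a time. *)
  apply (filterdiff_scal (K := R_AbsRing) (V := V) (k x, f x)).
  + intros P [d HP].
    pose proof (is_deriv_on_continuous f a Hf _ (locally_ball (f x) d)) as Cf.
    assert (Ck : filterlim k (within D (locally x)) (locally (k x))).
    { apply (filterdiff_continuous_aux (U := R_NormedModule) (V := R_NormedModule)).
      - eexists; exact Hk.
      - apply within_lim. }
    specialize (Ck _ (locally_ball (k x) d)).
    change (within D (locally x) (fun z => P (k z, f z))).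
    generalize (filter_and (F := within D (locally x))
      (fun z => ball (k x) d (k z)) (fun z => ball (f x) d (f z)) Ck Cf).
    apply filter_imp. intros z [B1 B2]. apply HP. split; [exact B1 | exact B2].
  + exact Rmult_comm.
- intros y. cbv beta. rewrite scal_distr_l, !scal_assoc.
  do 2 f_equal. exact (Rmult_comm (k x) y).
Qed.

(** [x] is an accumulation point of [D]. At an isolated point every vector would be a derivative,
    and the value chosen by [deriv_on] would carry no information. *)
Hypothesis D_acc : forall d, 0 < d -> exists z, D z /\ 0 < Rabs (z - x) < d.

(** Subtracting the two remainder estimates cancels the increment of [f] and bounds [(z - x)(a - b)]
    by [e |z - x|], with [e / 2] from each; dividing by [z - x], nonzero for a suitable [z], leaves
    [|a - b| <= e]. *)
Lemma is_deriv_on_unique (f : R -> V) (a b : V) : D x ->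
  is_deriv_on D f x a -> is_deriv_on D f x b -> a = b.
Proof.
intros Dx Ha Hb.
assert (H : norm (minus a b) <= 0).
{ apply le_epsilon. intros e He. rewrite Rplus_0_l.
  pose (e2 := mkposreal (e / 2) (Rdiv_lt_0_compat _ _ He Rlt_0_2)).
  pose proof (proj1 (is_deriv_on_iff f a Dx) Ha e2) as H1.
  pose proof (proj1 (is_deriv_on_iff f b Dx) Hb e2) as H2.
  destruct (filter_and _ _ H1 H2) as [d Hd].
  destruct (D_acc d (cond_pos d)) as [z [Dz [z0 zd]]].
  destruct (Hd z zd Dz) as [B1 B2].
  set (A := minus (f z) (f x)) in *.
  set (C := minus a b).
  assert (H3 : norm (scal (V := V) (z - x) C) <= e * Rabs (z - x)).
  { replace (scal (V := V) (z - x) C)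
      with (minus (minus A (scal (V := V) (z - x) b)) (minus A (scal (V := V) (z - x) a))).
    - eapply Rle_trans; [apply norm_triangle|].
      rewrite norm_opp.
      replace (e * Rabs (z - x)) with (e / 2 * Rabs (z - x) + e / 2 * Rabs (z - x))
        by field.
      exact (Rplus_le_compat _ _ _ _ B2 B1).
    - rewrite minus_minus_cancel. symmetry.
      exact (scal_minus_distr_l (K := R_AbsRing) (z - x) a b). }
  assert (z1 : z - x <> 0).
  { intros E0. rewrite E0, Rabs_R0 in z0. lra. }
  replace C with (scal (V := V) (/ (z - x)) (scal (V := V) (z - x) C)).
  - eapply Rle_trans; [apply norm_scal|].
    change (Rabs (/ (z - x)) * norm (scal (V := V) (z - x) C) <= e).
    rewrite Rabs_inv.
    apply Rmult_le_reg_l with (Rabs (z - x)); [exact z0|].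
    rewrite <- Rmult_assoc, Rinv_r by lra. lra.
  - rewrite scal_assoc.
    transitivity (scal (V := V) (one (K := R_AbsRing)) C); [|apply scal_one].
    f_equal. exact (Rinv_l _ z1). }
apply minus_zero_eq, norm_eq_zero, Rle_antisym; [exact H | apply norm_ge_0].
Qed.

Lemma deriv_on_spec (f : R -> V) :
  ex_deriv_on D f x -> is_deriv_on D f x (deriv_on D f x).
Proof. intros H. apply (epsilon_spec _ _ H). Qed.

Lemma deriv_on_eq (f : R -> V) (a : V) : D x ->
  is_deriv_on D f x a -> deriv_on D f x = a.
Proof.
intros Dx H. apply (is_deriv_on_unique f); trivial.
apply deriv_on_spec. now exists a.
Qed.

End DerivOn.

(** * Derivatives of dot products, norms and normalized vectors *)

(** Coordinates are linear forms, so each summand is a product of two differentiable real functions,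
    covered by [is_deriv_on_scal] with real values. *)
Lemma is_deriv_on_dot (D : R -> Prop) (x : R) (f g : R -> E3) (a b : E3) :
  D x -> is_deriv_on D f x a -> is_deriv_on D g x b ->
  is_deriv_on (V := R_NormedModule) D (fun z => dot (f z) (g z)) x
    (dot a (g x) + dot (f x) b).
Proof.
intros Dx Hf Hg.
assert (prod_rule : forall c : E3 -> R_NormedModule, is_linear c ->
  is_deriv_on (V := R_NormedModule) D (fun z => c (f z) * c (g z)) x
    (c a * c (g x) + c (f x) * c b)).
{ intros c Lc.
  assert (comp : forall (h : R -> E3) (d : E3), is_deriv_on D h x d ->
    is_deriv_on D (fun z => c (h z)) x (c d)).
  { intros h d Hh. apply is_deriv_on_comp; trivial. now apply filterdiff_linear. }
  exact (is_deriv_on_scal (V := R_NormedModule) D x _ _ _ _ Dx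
    (comp f a Hf) (comp g b Hg)). }
assert (Lxy := is_linear_fst (U := prod_NormedModule R_AbsRing R_NormedModule
  R_NormedModule) (V := R_NormedModule)).
assert (Hx := prod_rule cx (is_linear_comp _ _ Lxy
  (is_linear_fst (U := R_NormedModule) (V := R_NormedModule)))).
assert (Hy := prod_rule cy (is_linear_comp _ _ Lxy
  (is_linear_snd (U := R_NormedModule) (V := R_NormedModule)))).
assert (Hz := prod_rule cz (is_linear_snd (U := prod_NormedModule R_AbsRing
  R_NormedModule R_NormedModule) (V := R_NormedModule))).
pose proof (within_proper D x Dx) as PF.
unfold is_deriv_on.
apply (filterdiff_ext_lin (U := R_NormedModule) (V := R_NormedModule)) with
  (1 := filterdiff_plus_fct (U := R_NormedModule) (V := R_NormedModule) _ _ _ _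
     (filterdiff_plus_fct (U := R_NormedModule) (V := R_NormedModule) _ _ _ _ Hx Hy) Hz).
intros y. unfold dot, scal, plus; simpl; unfold mult; simpl. ring.
Qed.

Lemma is_deriv_on_norm (D : R -> Prop) (x : R) (f : R -> E3) (a : E3) :
  D x -> 0 < norm (f x) -> is_deriv_on D f x a ->
  is_deriv_on (V := R_NormedModule) D (fun z => norm (f z)) x
    (dot (f x) a / norm (f x)).
Proof.
intros Dx Hpos Hf.
assert (Hdot : 0 < dot (f x) (f x)).
{ rewrite norm_E3 in Hpos. destruct (Rle_lt_dec (dot (f x) (f x)) 0) as [H|H]; trivial.
  rewrite (sqrt_neg_0 _ H) in Hpos. lra. }
apply (is_deriv_on_ext (V := R_NormedModule)) with (fun z => sqrt (dot (f z) (f z))).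
- exact Dx.
- intros z _. symmetry. apply norm_E3.
- pose proof (is_deriv_on_comp (V := R_NormedModule) (W := R_NormedModule) D x
    _ _ sqrt _ Dx (is_deriv_on_dot D x f f a a Dx Hf Hf)
    (filterdiff_sqrt _ Hdot)) as H.
  replace (dot (f x) a / norm (f x))
    with (scal (dot a (f x) + dot (f x) a) (/ (2 * sqrt (dot (f x) (f x))))).
  + exact H.
  + rewrite <- norm_E3. unfold scal; simpl; unfold mult; simpl.
    unfold dot. field. lra.
Qed.

(** Applied to the velocity, this makes the unit tangent differentiable in [u]. *)
Lemma ex_deriv_on_normalize (D : R -> Prop) (x : R) (f : R -> E3) :
  D x -> 0 < norm (f x) -> ex_deriv_on D f x ->
  ex_deriv_on D (fun z => scal (/ norm (f z)) (f z)) x.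
Proof.
intros Dx Hpos [a Ha]. eexists.
apply (is_deriv_on_scal D x (fun z => / norm (f z))); [exact Dx| |exact Ha].
apply (is_deriv_on_comp (V := R_NormedModule) (W := R_NormedModule) D x
  _ _ Rinv (fun y => scal y (- 1 / (norm (f x)) ^ 2)) Dx
  (is_deriv_on_norm D x f a Dx Hpos Ha)).
apply (is_derive_inv (fun y => y) (norm (f x)) 1).
- apply (is_derive_id (norm (f x))).
- lra.
Qed.

(** * Injective linear maps from the plane are bounded below *)

Lemma mult_sqrt_le (a b k : R) :
  0 <= k -> k * k * a <= b -> 0 <= a -> k * sqrt a <= sqrt b.
Proof.
intros Hk H Ha. rewrite <- (sqrt_Rsqr k Hk) at 1.
rewrite <- sqrt_mult; [|apply Rle_0_sqr|exact Ha].
apply sqrt_le_1_alt. exact H.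
Qed.

Lemma norm_E2 (h : E2) : norm h = sqrt (fst h * fst h + snd h * snd h).
Proof.
destruct h as [p q].
change (sqrt ((Rabs p) ^ 2 + (Rabs q) ^ 2) = sqrt (p * p + q * q)).
rewrite !pow2_abs. f_equal. ring.
Qed.

Lemma dot_self_pos (a : E3) : a <> zero -> 0 < dot a a.
Proof.
intros Ha. apply Rnot_le_lt. intros H. apply Ha.
apply norm_eq_zero. rewrite norm_E3. apply sqrt_neg_0. exact H.
Qed.

(* The smallest eigenvalue of the Gram matrix of [L] is at least its determinant
   divided by its trace. *)
Lemma injective_linear_lower_bound (L : E2 -> E3) :
  is_linear L -> (forall h, L h = zero -> h = zero) ->
  exists k, 0 < k /\ forall h, k * norm h <= norm (L h).
Proof.
intros HL inj.
pose (e1 := (1, 0) : E2). pose (e2 := (0, 1) : E2).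
pose (A := dot (L e1) (L e1)). pose (B := dot (L e1) (L e2)).
pose (C := dot (L e2) (L e2)).
assert (Q : forall h : E2, dot (L h) (L h) =
  A * (fst h * fst h) + 2 * B * (fst h * snd h) + C * (snd h * snd h)).
{ intros h. destruct (h : R * R) as [p q].
  assert (E : L (p, q) = plus (scal p (L e1)) (scal q (L e2))).
  { rewrite <- !(linear_scal _ HL), <- (linear_plus _ HL). f_equal.
    change ((p, q) = (p * 1 + q * 0, p * 0 + q * 1)). apply f_equal2;
      [change (p = p * 1 + q * 0) | change (q = p * 0 + q * 1)]; simpl in p, q; ring. }
  rewrite E. unfold A, B, C. destruct (L e1) as [[a1 a2] a3], (L e2) as [[b1 b2] b3].
  unfold dot, cx, cy, cz; simpl. unfold plus, scal; simpl; unfold mult; simpl. ring. }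
assert (HA : 0 < A).
{ apply dot_self_pos. intros E. apply inj, (f_equal fst) in E. now apply R1_neq_R0. }
assert (HC : 0 <= C) by (unfold C, dot; nra).
(* The Gram form at [(- B, A)] equals [A (A C - B^2)], and it is positive by injectivity because [A]
   is nonzero. *)
assert (HD : 0 < A * C - B * B).
{ assert (H : 0 < dot (L (- B, A)) (L (- B, A))).
  { apply dot_self_pos. intros E. apply inj, (f_equal snd) in E.
    simpl in E. change (A = 0) in E. lra. }
  rewrite Q in H. simpl in H. nra. }
pose (m := (A * C - B * B) / (A + C)).
assert (Hm : 0 < m) by (apply Rdiv_lt_0_compat; lra).
exists (sqrt m). split; [now apply sqrt_lt_R0|].
intros h. rewrite norm_E2, norm_E3. apply mult_sqrt_le; [apply sqrt_pos| |].
2: { apply Rplus_le_le_0_compat; apply Rle_0_sqr. }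
rewrite sqrt_sqrt by lra. rewrite Q.
apply Rmult_le_reg_l with (A + C); [lra|].
unfold m. generalize (fst h : R) (snd h : R). intros p q.
replace ((A + C) * ((A * C - B * B) / (A + C) * (p * p + q * q)))
  with ((A * C - B * B) * (p * p + q * q)) by (field; lra).
(* The two sides differ exactly by [(A p + B q)^2 + (B p + C q)^2]. *)
pose proof (Rle_0_sqr (A * p + B * q)) as S1.
pose proof (Rle_0_sqr (B * p + C * q)) as S2.
unfold Rsqr in S1, S2. clearbody A B C. simpl in p, q. lra.
Qed.

(** * Algebra of the dot and cross products *)

(** Lagrange's identity: after squaring, the gap is the sum of the squared components of the cross
    product. *)
Lemma dot_Cauchy_Schwarz (a b : E3) : Rabs (dot a b) <= norm a * norm b.
Proof.
rewrite !norm_E3, <- sqrt_mult by (unfold dot; nra).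
rewrite <- sqrt_Rsqr_abs. apply sqrt_le_1_alt. unfold Rsqr.
pose proof (Rle_0_sqr (cx a * cy b - cy a * cx b)) as S1.
pose proof (Rle_0_sqr (cx a * cz b - cz a * cx b)) as S2.
pose proof (Rle_0_sqr (cy a * cz b - cz a * cy b)) as S3.
unfold Rsqr in S1, S2, S3. unfold dot. lra.
Qed.

Lemma dot_minus_r (a b c : E3) : dot a (minus b c) = dot a b - dot a c.
Proof.
change (cx a * (cx b + - cx c) + cy a * (cy b + - cy c) + cz a * (cz b + - cz c)
  = dot a b - dot a c).
unfold dot. ring.
Qed.

Lemma dot_plus_r (a b c : E3) : dot a (plus b c) = dot a b + dot a c.
Proof.
change (cx a * (cx b + cx c) + cy a * (cy b + cy c) + cz a * (cz b + cz c)
  = dot a b + dot a c).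
unfold dot. ring.
Qed.

Lemma dot_scal_r (a b : E3) (k : R) : dot a (scal k b) = k * dot a b.
Proof.
change (cx a * (k * cx b) + cy a * (k * cy b) + cz a * (k * cz b) = k * dot a b).
unfold dot. ring.
Qed.

Lemma dot_comm (a b : E3) : dot a b = dot b a.
Proof. unfold dot. ring. Qed.

Lemma dot_self_norm (a : E3) : dot a a = norm a * norm a.
Proof. rewrite norm_E3, sqrt_sqrt; [reflexivity | unfold dot; nra]. Qed.

Lemma dot_cross_l (a b : E3) : dot (cross a b) a = 0.
Proof. unfold dot, cross, vec, cx, cy, cz; cbn. ring. Qed.

Lemma dot_cross_r (a b : E3) : dot (cross a b) b = 0.
Proof. unfold dot, cross, vec, cx, cy, cz; cbn. ring. Qed.

Lemma dot_cross_self (a b : E3) :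
  dot (cross a b) (cross a b) = dot a a * dot b b - dot a b * dot a b.
Proof. unfold dot, cross, vec, cx, cy, cz; cbn. ring. Qed.

(** * Velocities of curves on the surface are orthogonal to the normal *)

(* Through the chart the curve has coordinates [phi], with
   [|phi z - phi x| = O(|z - x|)] because the differential of the chart is bounded
   below; hence [c z - c x] is a tangent vector up to [o(|z - x|)]. *)
Lemma normal_orthogonal_velocity (M : E3 -> Prop) (N : E3 -> E3)
    (D : R -> Prop) (x : R) (c : R -> E3) (a : E3) :
  regular_surface M -> unit_normal_field M N ->
  (forall d, 0 < d -> exists z, D z /\ 0 < Rabs (z - x) < d) ->
  D x -> (forall z, D z -> M (c z)) -> is_deriv_on D c x a ->
  dot (N (c x)) a = 0.
Proof.
intros HM [_ HN] D_acc Dx cM Hc.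
destruct (HM (c x) (cM x Dx)) as [U [W [X [dX [Y [HC Wx]]]]]].
destruct (HN (c x) (cM x Dx)) as [Nn Nt].
pose (q := Y (c x)).
destruct (chart_inv_image _ _ _ _ _ _ HC (c x) Wx (cM x Dx)) as [Uq Xq].
fold q in Uq, Xq.
destruct (chart_diff _ _ _ _ _ _ HC q Uq) as [Lin HX].
destruct (injective_linear_lower_bound (dX q) Lin) as [k [k_pos Hk]].
{ intros h. now apply (chart_regular _ _ _ _ _ _ HC). }
pose proof (within_proper D x Dx) as PF.
(* [W] is open and [c] is continuous at [x], so nearby points of the curve stay in the range of the
   chart. *)
assert (cW : within D (locally x) (fun z => W (c z) /\ M (c z))).
{ pose proof (is_deriv_on_continuous D x c a Hc W
    (chart_open_cod _ _ _ _ _ _ HC _ Wx)) as H.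
  unfold filtermap, within in *. revert H. apply filter_imp.
  intros z Hz Dz. split; [now apply Hz | now apply cM]. }
assert (phi_cont : filterlim (fun z => Y (c z)) (within D (locally x)) (locally q)).
{ intros P HP.
  pose proof (chart_inv_cont _ _ _ _ _ _ HC (c x) (conj Wx (cM x Dx)) P HP) as H1.
  pose proof (is_deriv_on_continuous D x c a Hc _ H1) as H2.
  unfold filtermap, within in *.
  generalize (filter_and _ _ H2 cW). apply filter_imp.
  intros z [B1 B2] Dz. apply B1; [exact Dz | now apply B2]. }
(* The derivative estimate with tolerance 1 gives the Lipschitz constant [norm a + 1] at [x]. *)
assert (Hlip : within D (locally x) (fun z =>
  norm (minus (c z) (c x)) <= (norm a + 1) * Rabs (z - x))).
{ pose proof (proj1 (is_deriv_on_iff D x c a Dx) Hc (mkposreal 1 Rlt_0_1)) as H.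
  unfold within in *. revert H. apply filter_imp. intros z Hz Dz.
  specialize (Hz Dz).
  assert (real : forall p q r s na, Rabs (p - q) <= r -> r <= 1 * s -> q <= s * na ->
    p <= (na + 1) * s).
  { intros p r0 r s na T1 T2 T3. apply Rabs_le_between in T1. lra. }
  exact (real _ _ _ _ _ (norm_triangle_inv _ _) Hz (norm_scal (V := E3) (z - x) a)). }
(* The height of the curve over the tangent plane has derivative 0. The product rule gives
   [dot (N (c x)) a] for the same derivative, and uniqueness concludes. *)
assert (H0 : is_deriv_on (V := R_NormedModule) D (fun z => dot (N (c x)) (c z)) x 0).
{ apply is_deriv_on_iff; [exact Dx|]. intros eps.
  assert (na : 0 <= norm a) by apply norm_ge_0.
  pose (K := 2 * (norm a + 1) / k).
  assert (K_pos : 0 < K) by (apply Rdiv_lt_0_compat; lra).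
  (* The bound [k / 2] lets half of the lower bound [k |h|] absorb the chart's remainder, whence
     [|h| <= K |z - x|]; the bound [eps / K] then makes that remainder at most [eps |z - x|]. *)
  assert (d_pos : 0 < Rmin (k / 2) (eps / K)).
  { apply Rmin_pos; [lra | apply Rdiv_lt_0_compat; [apply cond_pos | exact K_pos]]. }
  pose proof (phi_cont _ (HX q (fun P HP => HP) (mkposreal _ d_pos))) as H1.
  unfold filtermap, within in *.
  generalize (filter_and _ _ (filter_and _ _ H1 cW) Hlip). apply filter_imp.
  intros z [[B1 B2] B3] Dz.
  specialize (B1 Dz). specialize (B2 Dz). specialize (B3 Dz). simpl in B1.
  destruct B2 as [Wz Mz].
  rewrite Xq, (proj2 (chart_inv_image _ _ _ _ _ _ HC (c z) Wz Mz)) in B1.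
  set (h := minus (Y (c z)) q) in B1. set (b := minus (c z) (c x)) in *.
  pose proof (Hk h) as B4.
  pose proof (Rmin_l (k / 2) (eps / K)) as M1.
  pose proof (Rmin_r (k / 2) (eps / K)) as M2.
  set (m := Rmin (k / 2) (eps / K)) in *.
  assert (h0 : 0 <= norm h) by apply norm_ge_0.
  pose proof (norm_triangle_inv b (dX q h)) as T. apply Rabs_le_between in T.
  assert (hK : norm h <= K * Rabs (z - x)).
  { apply Rmult_le_reg_l with (k / 2); [lra|]. unfold K.
    replace (k / 2 * (2 * (norm a + 1) / k * Rabs (z - x)))
      with ((norm a + 1) * Rabs (z - x)) by (field; lra).
    assert (m * norm h <= k / 2 * norm h) by (now apply Rmult_le_compat_r).
    simpl in *; lra. }
  (* The linear part of the chart increment is tangent, so only the remainder [minus b (dX q h)]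
     contributes to the height. *)
  assert (E : dot (N (c x)) (dX q h) = 0).
  { apply Nt. exists U, W, X, dX, Y, q, h.
    exact (conj HC (conj Uq (conj Xq eq_refl))). }
  assert (G : minus (minus (dot (N (c x)) (c z)) (dot (N (c x)) (c x)))
      (scal (z - x) 0) = dot (N (c x)) (minus b (dX q h))).
  { unfold b. rewrite !dot_minus_r, E.
    unfold minus, plus, opp, scal; simpl. unfold mult; simpl. ring. }
  refine (Rle_trans _ (Rabs (dot (N (c x)) (minus b (dX q h)))) _ _ _).
  { rewrite <- G. apply Rle_refl. }
  eapply Rle_trans; [apply dot_Cauchy_Schwarz|]. rewrite Nn, Rmult_1_l.
  eapply Rle_trans; [exact B1|].
  apply Rle_trans with (eps / K * (K * Rabs (z - x))).
  - apply Rmult_le_compat; trivial. unfold m. now apply Rlt_le.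
  - right. field. lra. }
assert (H1 := is_deriv_on_dot D x (fun _ => N (c x)) c zero a Dx
  (is_deriv_on_const D x (N (c x))) Hc).
pose proof (is_deriv_on_unique (V := R_NormedModule) D x D_acc _ _ _ Dx H1 H0) as H.
cbv beta in H. unfold dot at 1 in H. unfold cx, cy, cz in H. simpl in H.
change (0 * fst (fst (c x)) + 0 * snd (fst (c x)) + 0 * snd (c x)
  + dot (N (c x)) a = 0) in H.
lra.
Qed.

(** * Accumulation points of the parameter intervals *)

Lemma u_dom_acc (l u : R) : 0 < l -> u_dom l u ->
  forall d, 0 < d -> exists z, u_dom l z /\ 0 < Rabs (z - u) < d.
Proof.
unfold u_dom. intros Hl Hu d Hd.
pose (e := Rmin (d / 2) (l / 2)).
assert (He : 0 < e /\ e <= d / 2 /\ e <= l / 2).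
{ repeat split; [apply Rmin_pos; lra | apply Rmin_l | apply Rmin_r]. }
(* From the left half of the interval step right, from the right half step left; [e <= l / 2] keeps
   the point inside. *)
clearbody e. destruct (Rle_lt_dec u (l / 2)).
- exists (u + e). rewrite Rabs_pos_eq; lra.
- exists (u - e). rewrite Rabs_left; lra.
Qed.

Lemma t_dom_acc (w t : R) : t_dom w t ->
  forall d, 0 < d -> exists z, t_dom w z /\ 0 < Rabs (z - t) < d.
Proof.
unfold t_dom. intros Ht d Hd.
pose (e := Rmin (d / 2) ((w - t) / 2)).
assert (He : 0 < e /\ e <= d / 2 /\ e <= (w - t) / 2).
{ repeat split; [apply Rmin_pos; lra | apply Rmin_l | apply Rmin_r]. }
(* The right end [w] is excluded, so there is always room to step right. *)
clearbody e. exists (t + e). rewrite Rabs_pos_eq; lra.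
Qed.

(** * The Darboux frame and the time derivative of the speed *)

Section Flow.

Variables (l w : R) (M : E3 -> Prop) (N : E3 -> E3) (alpha : R -> R -> E3)
  (f1 f2 f3 kg kn taug : R -> R -> R).
Hypotheses (l_pos : 0 < l) (surface_M : regular_surface M)
  (normal_N : unit_normal_field M N)
  (alpha_on_M : forall u t, u_dom l u -> t_dom w t -> M (alpha u t))
  (smooth : forall u t, u_dom l u -> t_dom w t ->
     differentiable_enough l w N alpha f1 f2 f3 u t)
  (speed_pos : forall u t, u_dom l u -> t_dom w t -> 0 < speed l alpha u t)
  (curvatures : darboux_equations l w N alpha kg kn taug)
  (flow : is_flow l w N alpha f1 f2 f3).

(** [T] is a normalized velocity and [n] a unit normal, orthogonal to it because the curve lies on
    [M]; the relations for [g] follow from those of the cross product [n x T]. *)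
Lemma darboux_orthonormal (u t : R) : u_dom l u -> t_dom w t ->
  let T := frame_T l alpha u t in
  let g := frame_g l N alpha u t in
  let n := frame_n N alpha u t in
  (dot T T = 1 /\ dot g g = 1 /\ dot n n = 1) /\
  (dot T g = 0 /\ dot T n = 0 /\ dot g n = 0).
Proof.
intros Hu Ht T g n.
assert (v_pos := speed_pos u t Hu Ht).
assert (TT : dot T T = 1).
{ unfold T, frame_T, ds. rewrite dot_scal_r, dot_comm, dot_scal_r, dot_self_norm.
  fold (speed l alpha u t). field. lra. }
assert (nn : dot n n = 1).
{ unfold n, frame_n. rewrite dot_self_norm.
  rewrite (proj1 (proj2 normal_N _ (alpha_on_M u t Hu Ht))). ring. }
assert (nT : dot n T = 0).
{ unfold n, frame_n, T, frame_T, ds. rewrite dot_scal_r.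
  rewrite (normal_orthogonal_velocity M N (u_dom l) u (fun u' => alpha u' t)
    (du l alpha u t)); trivial.
  - ring.
  - now apply u_dom_acc.
  - intros z Hz. now apply alpha_on_M.
  - apply deriv_on_spec, (alpha_du _ _ _ _ _ _ _ _ _ (smooth u t Hu Ht)). }
repeat split; trivial.
- unfold g, frame_g. rewrite dot_cross_self. fold T n. rewrite TT, nn, nT. ring.
- rewrite dot_comm. apply dot_cross_r.
- rewrite dot_comm. exact nT.
- apply dot_cross_l.
Qed.

(* Differentiate [T . d alpha/dt = f1] in [u]: as [T_u = v (kg g + kn n)],
   this avoids differentiating [g] and [n]. *)
Lemma dot_T_mixed (u t : R) : u_dom l u -> t_dom w t ->
  dot (frame_T l alpha u t) (dt w (du l alpha) u t) =
  du (V := R_NormedModule) l f1 u t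
  - speed l alpha u t * (f2 u t * kg u t + f3 u t * kn u t).
Proof.
intros Hu Ht.
assert (v_pos := speed_pos u t Hu Ht).
assert (S := smooth u t Hu Ht).
rewrite (alpha_mixed _ _ _ _ _ _ _ _ _ S).
assert (HT : is_deriv_on (u_dom l) (fun u' => frame_T l alpha u' t) u
    (du l (frame_T l alpha) u t)).
{ apply deriv_on_spec, ex_deriv_on_normalize; trivial.
  exact (alpha_dudu _ _ _ _ _ _ _ _ _ S). }
assert (HA : is_deriv_on (u_dom l) (fun u' => dt w alpha u' t) u
    (du l (dt w alpha) u t)).
{ apply deriv_on_spec. exact (alpha_dudt _ _ _ _ _ _ _ _ _ S). }
assert (Hf := is_deriv_on_dot _ _ _ _ _ _ Hu HT HA).
(* The flow equation and orthonormality hold along the whole curve, so [T . alpha_t] may be replaced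
   by [f1] before differentiating. *)
apply (is_deriv_on_ext (V := R_NormedModule)) with (g := fun u' => f1 u' t) in Hf;
  [|exact Hu|].
2: { intros z Hz.
  destruct (darboux_orthonormal z t Hz Ht) as [[TT _] [Tg [Tn _]]].
  change (dot (frame_T l alpha z t) (dt w alpha z t) = f1 z t).
  rewrite (flow z t Hz Ht), !dot_plus_r, !dot_scal_r, TT, Tg, Tn. ring. }
unfold du at 2.
rewrite (deriv_on_eq (V := R_NormedModule) _ _ (u_dom_acc l u l_pos Hu) _ _ Hu Hf).
destruct (darboux_orthonormal u t Hu Ht) as [[TT [gg nn]] [Tg [Tn gn]]].
destruct (curvatures u t Hu Ht) as [E _].
(* Divided by the speed, [T_u] becomes [kg g + kn n], whose product with the flow selects [f2] and
   [f3]. *)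
assert (ET : dot (dt w alpha u t) (du l (frame_T l alpha) u t)
    = speed l alpha u t * (f2 u t * kg u t + f3 u t * kn u t)).
{ apply (Rmult_eq_reg_l (/ speed l alpha u t));
    [|apply Rinv_neq_0_compat; lra].
  rewrite <- dot_scal_r.
  fold (ds l alpha (frame_T l alpha) u t). rewrite E.
  rewrite dot_plus_r, !dot_scal_r, (flow u t Hu Ht).
  rewrite !(dot_comm (plus _ _)), !dot_plus_r, !dot_scal_r.
  rewrite !(dot_comm _ (frame_T l alpha u t)), (dot_comm (frame_n N alpha u t) (frame_g _ _ _ _ _)), gg, nn, Tg, Tn, gn.
  field. lra. }
rewrite dot_comm in ET. rewrite ET. ring.
Qed.

(** The derivative of the norm of [alpha_u] is [T . alpha_ut], evaluated by [dot_T_mixed]. Existence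
    of the derivative is part of the claim, as [inextensible] demands it. *)
Lemma is_deriv_on_speed (u t : R) : u_dom l u -> t_dom w t ->
  is_deriv_on (V := R_NormedModule) (t_dom w) (fun t' => speed l alpha u t') t
    (speed l alpha u t * (ds (V := R_NormedModule) l alpha f1 u t
       - (f2 u t * kg u t + f3 u t * kn u t))).
Proof.
intros Hu Ht.
assert (v_pos := speed_pos u t Hu Ht).
replace (speed l alpha u t * _) with
  (dot (du l alpha u t) (dt w (du l alpha) u t) / norm (du l alpha u t)).
- apply (is_deriv_on_norm (t_dom w) t (fun t' => du l alpha u t')); trivial.
  apply deriv_on_spec. exact (alpha_dtdu _ _ _ _ _ _ _ _ _ (smooth u t Hu Ht)).
- transitivity (dot (frame_T l alpha u t) (dt w (du l alpha) u t)).
  + unfold frame_T, ds. rewrite (dot_comm (scal _ _)), dot_scal_r, dot_comm.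
    unfold Rdiv. apply Rmult_comm.
  + rewrite (dot_T_mixed u t Hu Ht). unfold ds.
    change (scal (/ speed l alpha u t) (du (V := R_NormedModule) l f1 u t))
      with (/ speed l alpha u t * du (V := R_NormedModule) l f1 u t).
    field. lra.
Qed.

End Flow.

Theorem theorem3p1 (l w : R) (M : E3 -> Prop) (N : E3 -> E3)
    (alpha : R -> R -> E3) (f1 f2 f3 kg kn taug : R -> R -> R)
    (l_pos : 0 < l) (w_pos : 0 < w)
    (surface_M : regular_surface M)
    (normal_N : unit_normal_field M N)
    (alpha_on_M : forall u t, u_dom l u -> t_dom w t -> M (alpha u t))
    (smooth : forall u t, u_dom l u -> t_dom w t ->
       differentiable_enough l w N alpha f1 f2 f3 u t)
    (speed_pos : forall u t, u_dom l u -> t_dom w t -> 0 < speed l alpha u t)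
    (curvatures : darboux_equations l w N alpha kg kn taug)
    (flow : is_flow l w N alpha f1 f2 f3) :
  inextensible l w alpha <->
  (forall u t, u_dom l u -> t_dom w t ->
     ds (V := R_NormedModule) l alpha f1 u t
       = f2 u t * kg u t + f3 u t * kn u t).
Proof.
assert (Hv := is_deriv_on_speed l w M N alpha f1 f2 f3 kg kn taug l_pos surface_M
  normal_N alpha_on_M smooth speed_pos curvatures flow).
split; intros H u t Hu Ht; specialize (Hv u t Hu Ht); specialize (H u t Hu Ht).
- assert (v_pos := speed_pos u t Hu Ht).
  (* Both the computed value and 0 are derivatives of the speed, so they agree; positivity of the
     speed then removes that factor. *)
  assert (E := is_deriv_on_unique (V := R_NormedModule) _ _ (t_dom_acc w t Ht)
    _ _ _ Ht Hv H).
  apply Rmult_integral in E. destruct E as [E|E]; [lra|].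
  now apply Rminus_diag_uniq.
- rewrite H, Rminus_diag, Rmult_0_r in Hv. exact Hv.
Qed.
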